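(* Let $b<-1$, let $x^*=\frac{1}{b-1}$, and let $\epsilon>0$. Put $$I_0(\epsilon,b)=(bx^*-|b|\epsilon,\;bx^*-\epsilon]\;\cup\;[bx^*+\epsilon,\;bx^*+|b|\epsilon).$$ Then for every function $y_0:I_0(\epsilon,b)\to\mathbb{R}$, the initial value problem for the functional equation $y(x+1)=y(bx)$ with initial condition $y(x)=y_0(x)$ for $x\in I_0(\epsilon,b)$ has a unique solution on $\mathbb{R}\setminus\{bx^*\}$.
   Context: A solution of the initial value problem on a set $J\subseteq\mathbb{R}$ is a function $y:J\to\mathbb{R}$ that satisfies $y(x+1)=y(bx)$ for all real $x$ with $x+1\in J$ and $bx\in J$, and agrees with the initial function on its domain. No continuity is assumed. The point $x^*=\frac1{b-1}$ is the solution of $x+1=bx$, so $bx^*=x^*+1$. *)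

(* Defs.v *)
From mathcomp Require Import all_boot all_order all_algebra.
From mathcomp Require Import all_classical all_reals.
Set Implicit Arguments.
Unset Strict Implicit.
Unset Printing Implicit Defensive.
Import Order.TTheory GRing.Theory Num.Theory.
Local Open Scope classical_set_scope.
Local Open Scope ring_scope.

Definition xstar (R : realType) (b : R) : R := 1 / (b - 1).

Definition I0 (R : realType) (eps b : R) : set R :=
  `]b * xstar b - `|b| * eps, b * xstar b - eps] `|`
  `[b * xstar b + eps, b * xstar b + `|b| * eps[.

Definition punctured_line (R : realType) (b : R) : set R :=
  ~` [set b * xstar b].

(* A function on a set J is a function on the subtype of its elements. The
   equation is required only at those x for which x + 1 and b * x both lie in
   J; the elements u and v of J carry these two values. *)
Definition satisfies_equation (R : realType) (b : R) (J : set R)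
    (y : J -> R) : Prop :=
  forall (x : R) (u v : J), val u = x + 1 -> val v = b * x -> y u = y v.

(* This includes the requirement that the domain I of y0 is contained in J. *)
Definition agrees_on (R : realType) (J I : set R) (y : J -> R)
    (y0 : I -> R) : Prop :=
  forall z : I, exists2 u : J, val u = val z & y u = y0 z.

Definition is_solution (R : realType) (b : R) (J I : set R) (y0 : I -> R)
    (y : J -> R) : Prop :=
  satisfies_equation b y /\ agrees_on y y0.

(* Main.v *)
(* The variable t = x - b x* turns the equation into y(t) = y(b t): since
   x* + 1 = b x*, the points x + 1 and b x have coordinates t and b t with
   t = x - x*.  Thus a solution off t = 0 is a function on the orbits of t |-> b t,
   and the initial domain eps <= |t| < |b| eps meets each orbit exactly once,
   because |b| > 1. *)
Require Import Defs.
From mathcomp Require Import all_boot all_order all_algebra.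
From mathcomp Require Import all_classical all_reals.
From mathcomp Require Import ring lra.
Import Order.TTheory GRing.Theory Num.Theory.
Local Open Scope classical_set_scope.
Local Open Scope ring_scope.

Lemma bernoulli_le_expr {R : realFieldType} {r : R} (n : nat) :
  1 <= r -> 1 + n%:R * (r - 1) <= r ^+ n.
Proof.
move=> r1; elim: n => [|n IHn]; first by rewrite expr0; lra.
have r0 : 0 <= r - 1 by lra.
have nr : 0 <= n%:R :> R by [].
have := ler_wpM2l (le_trans ler01 r1) IHn; rewrite -exprS; apply: le_trans.
have := mulr_ge0 nr (sqr_ge0 (r - 1)).
by rewrite -natr1; lra.
Qed.

Lemma exists_lt_expr {R : archiRealFieldType} {r : R} (s : R) :
  1 < r -> exists n : nat, s < r ^+ n.
Proof.
(* With this exponent [n], the product [n * (r - 1)] exceeds [|s|], so Bernoulli's inequality puts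
   [r ^+ n] above [s]. *)
move=> r1; exists (Num.bound (`|s| / (r - 1))).
have r0 : 0 < r - 1 by lra.
apply: lt_le_trans (bernoulli_le_expr _ (ltW r1)).
have /archi_boundP : 0 <= `|s| / (r - 1) by rewrite divr_ge0 // ltW.
by rewrite ltr_pdivrMr // => ?; have := ler_norm s; lra.
Qed.

(** Dividing by a power [r ^+ M > s / eps] first brings [s] below [eps], which reduces the search to
    natural exponents. The least [n] that climbs back to [eps] is then positive, and minimality at
    its predecessor gives the upper bound. *)
Lemma exists_exprz_between {R : archiRealFieldType} {r eps s : R} :
  1 < r -> 0 < eps -> 0 < s ->
  exists n : int, eps <= r ^ n * s < r * eps.
Proof.
move=> r1 e0 s0; have r0 : 0 < r by lra.
have [M hM] := exists_lt_expr (s / eps) r1.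
have hex : exists n, eps <= r ^+ n / r ^+ M * s.
  have [n hn] := exists_lt_expr (eps / s * r ^+ M) r1; exists n.
  by rewrite -ler_pdivrMr // ler_pdivlMr ?exprn_gt0 // ltW.
have [n hn nmin] := ex_minnP hex.
case: n hn nmin => [|n] hn nmin.
  move: hn; rewrite expr0 mul1r mulrC ler_pdivlMr ?exprn_gt0 // mulrC.
  by rewrite -ler_pdivlMr // leNgt hM.
exists (n.+1%:Z - M%:Z).
rewrite expfzDr ?gt_eqF // -exprnN -exprnP hn /=.
have /negP : ~ eps <= r ^+ n / r ^+ M * s by move=> /nmin; rewrite ltnn.
by rewrite -ltNge exprS -!mulrA ltr_pM2l.
Qed.

(** The window has end ratio exactly [r] and omits its upper end, so a factor [r ^+ m.+1] always
    leaves it. *)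
Lemma exprz_between_eq0 {R : realFieldType} {r eps s : R} {n : int} :
  1 < r -> 0 < eps -> eps <= s < r * eps -> eps <= r ^ n * s < r * eps -> n = 0.
Proof.
move=> r1 e0; have r0 : 0 < r by lra.
have absurd (m : nat) x : eps <= x -> r ^+ m.+1 * x < r * eps -> False.
  move=> ex; rewrite exprS -mulrA ltr_pM2l // ltNge => /negP; apply.
  have : 1 * x <= r ^+ m * x.
    by rewrite ler_wpM2r ?exprn_ege1 ?ltW //; lra.
  by rewrite mul1r; apply: le_trans.
case: n => [[//|m]|m] /andP[es se] /andP[es' se'].
  by case: (absurd m s es).
(* For a negative exponent the two points exchange roles. *)
case: (absurd m _ es'); move: se.
by rewrite NegzE -exprnN mulVKf // gt_eqF // exprn_gt0.
Qed.

Lemma normr_exprz {R : numFieldType} (x : R) (n : int) : `|x ^ n| = `|x| ^ n.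
Proof. by case: n => n; rewrite ?NegzE -?exprnN -?exprnP ?normfV normrX. Qed.

Lemma mem_I0 {R : realType} (eps b x : R) : 0 < eps -> b < -1 ->
  (x \in I0 eps b) = (eps <= `|x - b * xstar b| < `|b| * eps).
Proof.
move=> e0 b1; rewrite /I0; set c := b * xstar b; set d := `|b| * eps.
have [xc|xc] := ger0P (x - c); apply/idP/idP; rewrite inE /= !in_itv /=.
- by case=> /andP[? ?]; lra.
- by move=> /andP[? ?]; right; lra.
- by case=> /andP[? ?]; lra.
- by move=> /andP[? ?]; left; lra.
Qed.

Lemma mem_punctured_line {R : realType} (b x : R) :
  (x \in punctured_line b) = (x != b * xstar b).
Proof.
by apply/idP/idP; rewrite inE /punctured_line /= => /eqP.
Qed.

Lemma lt_N1_neq0 {R : numDomainType} {b : R} : b < -1 -> b != 0.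
Proof. by move=> b1; rewrite lt_eqF // (lt_trans b1) ?ltrN10. Qed.

Lemma xstar_fixed {R : realType} {b : R} : b < -1 -> b * xstar b = xstar b + 1.
Proof. by move=> b1; rewrite /xstar; field; lra. Qed.

Section Orbits.
Context {R : realType} {b : R} (b_lt : b < -1).

Let c := b * xstar b.

Lemma solution_step (y : punctured_line b -> R) (u v : punctured_line b) :
  satisfies_equation b y -> val v - c = b * (val u - c) -> y u = y v.
Proof.
have cE := xstar_fixed b_lt.
(* At [x = val u - 1] the equation relates [u] to [b * x], which is [val v] because
   [b * c = c + b]. *)
move=> eqy uv; apply: (eqy (val u - 1)); first by rewrite subrK.
have : b * c = b * xstar b + b by rewrite /c {1}cE mulrDr mulr1.
by move: uv; rewrite /c => uv; lra.
Qed.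

Lemma solution_orbit (y : punctured_line b -> R) (u v : punctured_line b)
    (n : int) :
  satisfies_equation b y -> val v - c = b ^ n * (val u - c) -> y u = y v.
Proof.
have b0 := lt_N1_neq0 b_lt.
(* A negative power from [u] to [v] is a positive one from [v] to [u]. *)
move=> eqy; wlog: n u v / exists m : nat, n = m.
  move=> wlogn; case: n => m uv; first by apply: (wlogn m) => //; exists m.
  apply/esym/(wlogn m.+1); first by exists m.+1.
  by rewrite uv NegzE -exprnN -?exprnP mulVKf // expf_neq0.
case=> m ->; rewrite -exprnP => {n}; elim: m v => [|m IHm] v.
  by rewrite expr0 mul1r => /addIr/val_inj ->.
rewrite exprS -mulrA => uv.
(* The intermediate orbit point must lie in the domain; it avoids [c] since [b] and [val u - c] are
   nonzero. *)
have w_in : b ^+ m * (val u - c) + c \in punctured_line b.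
  rewrite mem_punctured_line -subr_eq0 addrK mulf_neq0 ?expf_neq0 //.
  by rewrite subr_eq0 -mem_punctured_line; apply: valP.
pose w : punctured_line b := SigSub w_in.
rewrite (IHm w) /= ?addrK //.
by apply: solution_step => //; rewrite /= addrK.
Qed.

Context {eps : R} (eps_gt0 : 0 < eps).

Lemma norm_b_gt1 : 1 < `|b|.
Proof. by rewrite ltr0_norm ?(lt_trans b_lt) ?ltrN10 // ltrNr. Qed.

Lemma orbit_meets_I0 (u : punctured_line b) :
  exists z : I0 eps b, exists n : int, val z - c = b ^ n * (val u - c).
Proof.
have uc : 0 < `|val u - c|.
  by rewrite normr_gt0 subr_eq0 -mem_punctured_line; apply: valP.
have [n hn] := exists_exprz_between norm_b_gt1 eps_gt0 uc.
have z_in : b ^ n * (val u - c) + c \in I0 eps b.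
  by rewrite mem_I0 // addrK normrM normr_exprz.
by exists (SigSub z_in), n; rewrite /= addrK.
Qed.

Lemma orbit_meets_I0_once (z z' : I0 eps b) (n : int) :
  val z' - c = b ^ n * (val z - c) -> z' = z.
Proof.
have := valP z; have := valP z'; rewrite !mem_I0 //.
move=> hz' hz zz'; move: hz'; rewrite -/c zz' normrM normr_exprz => hz'.
have n0 := exprz_between_eq0 norm_b_gt1 eps_gt0 hz hz'.
by apply/val_inj/(addIr (- c)); rewrite zz' n0 expr0z mul1r.
Qed.

Definition orbit_rep (u : punctured_line b) : I0 eps b :=
  sval (cid (orbit_meets_I0 u)).

Lemma orbit_repP (u : punctured_line b) :
  exists n : int, val (orbit_rep u) - c = b ^ n * (val u - c).
Proof. exact: svalP (cid (orbit_meets_I0 u)). Qed.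

(** This makes the arbitrary choice in [orbit_rep] harmless: two points of [I0] on the orbit of [u]
    differ by a power of [b], hence coincide. *)
Lemma orbit_rep_eq (u : punctured_line b) (z : I0 eps b) (n : int) :
  val z - c = b ^ n * (val u - c) -> orbit_rep u = z.
Proof.
have b0 := lt_N1_neq0 b_lt.
have [m um] := orbit_repP u => zu.
apply: (@orbit_meets_I0_once _ _ (m - n)).
by rewrite um zu mulrA -expfzDr // subrK.
Qed.

End Orbits.

Theorem theorem2p21 (R : realType) (b eps : R) (hb : b < -1) (heps : 0 < eps)
    (y0 : I0 eps b -> R) :
  exists! y : punctured_line b -> R, is_solution b y0 y.
Proof.
have b0 := lt_N1_neq0 hb.
have embed (z : I0 eps b) : exists u : punctured_line b, val u = val z.
  have z_in : val z \in punctured_line b.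
    rewrite mem_punctured_line -subr_eq0 -normr_gt0.
    by have := valP z; rewrite mem_I0 // => /andP[]; lra.
  by exists (SigSub z_in).
(* The solution extends [y0] constantly along each orbit. *)
exists (y0 \o orbit_rep hb heps); split; first split.
- move=> x u v ux vx /=; congr y0.
  have [n vn] := orbit_repP hb heps v.
  (* Measured from [b * xstar b], [v] is [b] times [u], so the representative of [v] is one step
     further from [u]. *)
  apply: (@orbit_rep_eq _ _ _ _ _ _ _ (n + 1)).
  rewrite vn expfzDr // expr1z -mulrA; congr (_ * _).
  by rewrite vx ux xstar_fixed //; have := xstar_fixed hb; lra.
- move=> z; have [u uz] := embed z; exists u => //=; congr y0.
  by apply: (@orbit_rep_eq _ _ _ _ _ _ _ 0); rewrite expr0z mul1r uz.
(* Any solution is constant on the orbit of [u], so its value is the one prescribed at the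
   representative. *)
- move=> y [eqy agr]; apply/funext => u /=.
  have [n un] := orbit_repP hb heps u.
  have [v vz <-] := agr (orbit_rep hb heps u).
  by apply/esym/(@solution_orbit _ _ hb _ _ _ n) => //; rewrite vz.
Qed.
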